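(* Let $1<p,q<\infty$ with $\frac1p+\frac1q=1$, and let $J:l_p\to l_q$ be the normalized duality mapping of the real Banach space $l_p$. Let $x,y\in l_p$. If $\langle J(x),y\rangle\neq 0$, then $$\theta\notin\widehat{D}^*J(x)(y).$$
   Context: $l_p$ and $l_q$ are the real sequence spaces with norms $\|\cdot\|_p$, $\|\cdot\|_q$; $l_p^*=l_q$, $l_q^*=l_p$; $\langle w,x\rangle=\sum_n w_nx_n$ is the pairing of $w\in l_q$ with $x\in l_p$; $\theta=(0,0,\ldots)$ denotes the origin of both $l_p$ and $l_q$. For $x\in l_p$, $J(x)$ is the unique element of $l_q$ with $\langle J(x),x\rangle=\|x\|_p^2=\|J(x)\|_q^2$; explicitly $J(\theta)=\theta$ and, for $x\ne\theta$, $J(x)=\left(\frac{|x_n|^{p-1}\operatorname{sign}(x_n)}{\|x\|_p^{p-2}}\right)_{n\ge1}$. The Mordukhovich derivative (coderivative) of $J$ at $(x,J(x))$ is the set-valued mapping $\widehat{D}^*J(x):l_p\rightrightarrows l_q$ defined, for $y\in l_p$, by $$\widehat{D}^*J(x)(y)=\left\{w\in l_q:\ \limsup_{z\to x}\frac{\langle w,z-x\rangle-\langle J(z)-J(x),y\rangle}{\|z-x\|_p+\|J(z)-J(x)\|_q}\le 0\right\},$$ where $z\to x$ in the norm of $l_p$ with $z\neq x$. *)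

(* Defs.v *)
From HB Require Import structures.
From mathcomp Require Import all_boot all_order all_algebra.
From mathcomp Require Import all_classical all_reals all_analysis.
From mathcomp Require Import ring.
Set Implicit Arguments.
Unset Strict Implicit.
Unset Printing Implicit Defensive.
Import Order.TTheory GRing.Theory Num.Theory.
Import numFieldNormedType.Exports.
Local Open Scope classical_set_scope.
Local Open Scope ring_scope.

Section lp_space.
Context {R : realType} {p : R} (p1 : 1 < p).

Definition lp_exponent : (1 <= p%:E)%E := ltW p1.

(* As nat carries the discrete sigma-algebra and the counting measure, these
   are exactly the real sequences x such that \sum_n |x_n|^p is finite;
   equality is pointwise equality (lpP), no almost everywhere quotient being
   involved. *)
Definition lp : Type := LfunType (@counting nat R) lp_exponent.

HB.instance Definition _ := GRing.Lmodule.on lp.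

Definition lp_seq (x : lp) : nat -> R := x.
Coercion lp_seq : lp >-> Funclass.

Definition lp_norm (x : lp) : R := fine ('N[counting]_p%:E [EFin \o x])%E.

Lemma lpP (x y : lp) : x = y <-> x =1 y.
Proof. exact: LfuneqP. Qed.

Lemma lp_normD (x y : lp) : lp_norm (x + y) <= lp_norm x + lp_norm y.
Proof. exact: ler_LnormD. Qed.

Lemma lp_normZ (a : R) (x : lp) : lp_norm (a *: x) = `|a| * lp_norm x.
Proof.
apply: EFin_inj; rewrite EFinM /lp_norm !finite_norm_fine; exact: LnormZ.
Qed.

Lemma lp_norm_sum (x : lp) :
  (\sum_(n <oo) (`|x n| `^ p)%:E = (lp_norm x `^ p)%:E)%E.
Proof.
have p0 : 0 < p by exact: lt_trans ltr01 p1.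
rewrite -poweR_EFin /lp_norm finite_norm_fine Lnorm_counting// -poweRrM.
rewrite mulVf ?gt_eqF// poweRe1//.
by apply: nneseries_ge0 => n _ _; rewrite lee_fin powR_ge0.
Qed.

Lemma lp_norm_eq0 (x : lp) : lp_norm x = 0 -> x = 0.
Proof.
have p0 : 0 < p by exact: lt_trans ltr01 p1.
move=> x0; apply/lpP => n.
have : ((`|x n| `^ p)%:E <= \sum_(k <oo) (`|x k| `^ p)%:E)%E.
  rewrite (@nneseriesD1 _ (fun k => (`|x k| `^ p)%:E) n predT)//.
  by rewrite leeDl// nneseries_ge0// => k _ _; rewrite lee_fin powR_ge0.
rewrite lp_norm_sum x0 powR0 ?gt_eqF// lee_fin => xn.
have : `|x n| `^ p = 0 by apply/eqP; rewrite eq_le xn powR_ge0.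
by move=> /powR_eq0_eq0 /normr0_eq0 ->.
Qed.

(* The topology of lp, and with it the punctured neighborhoods x^', is the one
   induced by the norm. *)
HB.instance Definition _ :=
  Lmodule_isNormed.Build R lp lp_normD lp_normZ lp_norm_eq0.

Lemma lp_normE (x : lp) : `|x| = lp_norm x. Proof. by []. Qed.

End lp_space.
Arguments lp {R p} p1.

Section series_lemmas.
Context {R : realType}.
Implicit Types f : nat -> R.

Lemma series_cvg_esum f (S : R) : (forall n, 0 <= f n) ->
  (\sum_(n <oo) (f n)%:E = S%:E)%E <-> series f @ \oo --> S.
Proof.
move=> f0.
have E : (fun n => \sum_(0 <= i < n) (f i)%:E)%E = EFin \o series f.
  by apply/funext => n; rewrite /= sumEFin.
split.
  move=> fS.
  have : (fun n => \sum_(0 <= i < n) (f i)%:E)%E @ \oo --> S%:E.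
    rewrite -fS; apply: is_cvg_nneseries => n _ _; by rewrite lee_fin.
  by rewrite E => /fine_cvgP[].
move=> fS; apply/cvg_lim => //; rewrite E; apply/fine_cvgP.
by split; [exact: nearW|exact: fS].
Qed.

Lemma young_eq (a b p q : R) : 0 <= a -> 0 <= b -> 0 < p -> 0 < q ->
  p^-1 + q^-1 = 1 -> a * b = a `^ p / p + b `^ q / q -> a `^ p = b `^ q.
Proof.
move=> a0 b0 p0 q0 pq abE.
have [a00|an0] := eqVneq a 0.
  move: abE; rewrite a00 mul0r powR0 ?gt_eqF// mul0r add0r => /esym/eqP.
  by rewrite mulf_eq0 invr_eq0 [q == 0]gt_eqF// orbF => /eqP.
have [b00|bn0] := eqVneq b 0.
  move: abE; rewrite b00 mulr0 [0 `^ q]powR0 ?gt_eqF// mul0r addr0 => /esym/eqP.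
  by rewrite mulf_eq0 invr_eq0 [p == 0]gt_eqF// orbF => /eqP.
have ap : 0 < a by rewrite lt_def an0.
have bp : 0 < b by rewrite lt_def bn0.
move: abE; rewrite /powR (negbTE an0) (negbTE bn0).
set s := p * ln a; set t := q * ln b.
have [->//|st] := eqVneq s t.
have -> : a * b = expR (s / p + t / q).
  rewrite /s /t mulrAC divff ?gt_eqF// mul1r mulrAC divff ?gt_eqF// mul1r.
  by rewrite expRD !lnK ?posrE.
set m := s / p + t / q => mE.
have sm : s - m = (s - t) / q.
  have -> : m = s * p^-1 + t * q^-1 by [].
  have -> : p^-1 = 1 - q^-1 by rewrite -pq addrK.
  by ring.
have tm : t - m = (t - s) / p.
  have -> : m = s * p^-1 + t * q^-1 by [].
  have -> : q^-1 = 1 - p^-1 by rewrite -pq addrAC addrN add0r.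
  by ring.
have hs : 1 + (s - m) < expR (s - m).
  by apply: expR_gt1Dx; rewrite sm mulf_neq0 ?subr_eq0// invr_eq0 gt_eqF.
have ht : 1 + (t - m) < expR (t - m).
  apply: expR_gt1Dx; rewrite tm mulf_neq0 ?invr_eq0 ?[p == 0]gt_eqF//.
  by rewrite subr_eq0 eq_sym.
have : 1 < expR (s - m) / p + expR (t - m) / q.
  have -> : 1 = (1 + (s - m)) / p + (1 + (t - m)) / q.
    rewrite sm tm -[LHS]pq; ring.
  by rewrite ltrD// ltr_pM2r ?invr_gt0.
rewrite !expRB mulrAC [X in _ + X]mulrAC -mulrDl -mE divff ?ltxx//.
by rewrite gt_eqF ?expR_gt0.
Qed.

End series_lemmas.

Section duality.
Context {R : realType} {p q : R} {p1 : 1 < p}.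

(* Stated for arbitrary sequences; the series converges for w in l_q and x in
   l_p (pairing_cvg). *)
Definition pairing (w x : nat -> R) : R := limn (series (w \* x)).

(* For x = 0 this is the zero sequence since Num.sg 0 = 0. *)
Definition J_seq (x : lp p1) (n : nat) : R :=
  `|x n| `^ (p - 1) * Num.sg (x n) / `|x| `^ (p - 2).

Context (q1 : 1 < q) (pq : p^-1 + q^-1 = 1).

Let p0 : 0 < p. Proof. exact: lt_trans ltr01 p1. Qed.
Let q0 : 0 < q. Proof. exact: lt_trans ltr01 q1. Qed.
Let pn0 : p != 0. Proof. by rewrite gt_eqF. Qed.
Let qn0 : q != 0. Proof. by rewrite gt_eqF. Qed.
Let pqE : (p - 1) * q = p.
Proof.
have : (p^-1 + q^-1) * (p * q) = p * q by rewrite pq mul1r.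
rewrite mulrDl mulrA mulVf// mul1r mulrCA mulVf// mulr1 => H.
by rewrite mulrBl mul1r -H addrAC addrN add0r.
Qed.

Lemma J_seq_norm (x : lp p1) n :
  `|J_seq x n| = `|x n| `^ (p - 1) / `|x| `^ (p - 2).
Proof.
rewrite /J_seq !normrM [`|_^-1|]ger0_norm ?invr_ge0 ?powR_ge0//; congr (_ / _).
rewrite [`|_ `^ _|]ger0_norm ?powR_ge0// normr_sg.
have [->|] := eqVneq (x n) 0; last by rewrite mulr1.
by rewrite normr0 powR0 ?mul0r// gt_eqF// subr_gt0.
Qed.

Lemma J_seq_sum (x : lp p1) : (\sum_(n <oo) (`|J_seq x n| `^ q)%:E =
  (`|x| `^ p / `|x| `^ ((p - 2) * q))%:E)%E.
Proof.
transitivity (\sum_(n <oo) ((`|x| `^ ((p - 2) * q))^-1%:E * (`|x n| `^ p)%:E))%E.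
  apply: eq_eseriesr => n _; rewrite -EFinM J_seq_norm; congr EFin.
  rewrite powRM ?invr_ge0 ?powR_ge0// -powRrM pqE mulrC; congr (_ * _).
  by rewrite -!powRN -powRrM mulNr.
rewrite nneseriesZl ?lp_norm_sum//.
by rewrite -EFinM mulrC.
Qed.

Lemma J_seq_Lfun (x : lp p1) : J_seq x \in Lfun (@counting nat R) q%:E.
Proof.
rewrite inE; apply/andP; split; rewrite inE//=.
rewrite /finite_norm Lnorm_counting//.
by rewrite [X in (X `^ _)%E](J_seq_sum x) poweR_lty// ltry.
Qed.

Definition J (x : lp p1) : lp q1 := Lfun_Sub (lp_exponent q1) (J_seq_Lfun x).

Lemma J_norm (x : lp p1) : `|J x| = `|x|.
Proof.
apply: (powR_injective q0); rewrite ?nnegrE ?normr_ge0//.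
apply: EFin_inj; rewrite lp_normE -lp_norm_sum J_seq_sum; congr EFin.
have [->|x0] := eqVneq x 0.
  by rewrite normr0 (powR0 pn0) (powR0 qn0) mul0r.
rewrite -powRB; last by rewrite normr_eq0 x0 implybT.
by congr (_ `^ _); rewrite -[X in X - _]pqE; ring.
Qed.

Lemma pairing_cvg (w : lp q1) (x : lp p1) : cvgn (series (w \* x)).
Proof.
apply: normed_cvg.
apply: nnseries_is_cvg => [n|]; first exact: normr_ge0.
have h := @hoelder _ _ _ (@counting nat R) w x q p.
have : ('N[@counting nat R]_1 [EFin \o (w \* x)%R] < +oo)%E.
  apply: le_lt_trans (h _ _ _ _ _) _ => //; first by rewrite addrC.
  by rewrite -[X in (X * _)%E]finite_norm_fine -[X in (_ * X)%E]finite_norm_fine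
    -EFinM ltry.
rewrite -[1%E]/(1%:E) Lnorm_counting// invr1 poweRe1//.
  move=> H; apply: le_lt_trans H; rewrite le_eqVlt; apply/orP; left; apply/eqP.
  by apply: eq_eseriesr => n _; rewrite /= powRr1.
by apply: nneseries_ge0 => n _ _; exact: poweR_ge0.
Qed.

Lemma J_pairing (x : lp p1) : pairing (J x) x = `|x| ^+ 2.
Proof.
apply/cvg_lim => //; apply/series_cvg_esum.
  move=> n; rewrite /= /J_seq.
  have -> : `|x n| `^ (p - 1) * Num.sg (x n) / `|x| `^ (p - 2) * x n =
            `|x n| `^ (p - 1) * `|x n| / `|x| `^ (p - 2).
    by rewrite [X in _ = _ * X / _]normrEsg; ring.
  by rewrite mulr_ge0 ?invr_ge0 ?mulr_ge0 ?powR_ge0.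
transitivity (\sum_(n <oo) ((`|x| `^ (p - 2))^-1%:E * (`|x n| `^ p)%:E))%E.
  apply: eq_eseriesr => n _; rewrite -EFinM; congr EFin.
  rewrite -[LHS]/(J_seq x n * x n) /J_seq -(mulr_powRB1 (normr_ge0 (x n)) p0).
  by rewrite [X in _ = _ * (X * _)]normrEsg; ring.
rewrite nneseriesZl ?lp_norm_sum//.
rewrite -EFinM mulrC; congr EFin; rewrite -lp_normE.
have [->|x0] := eqVneq x 0; first by rewrite normr0 powR0// mul0r expr0n.
rewrite -powRB; last by rewrite normr_eq0 x0 implybT.
by rewrite opprB addrCA addrN addr0 powR_mulrn.
Qed.

Lemma J_unique (x : lp p1) (w : lp q1) :
  pairing w x = `|x| ^+ 2 -> `|w| = `|x| -> w = J x.
Proof.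
move=> wx wN.
have [x0|x0] := eqVneq x 0.
  have -> : w = 0 by apply/normr0_eq0; rewrite wN x0 normr0.
  by apply/esym/normr0_eq0; rewrite J_norm x0 normr0.
set N := `|x|; have N0 : 0 < N by rewrite normr_gt0.
have Nge0 : 0 <= N by exact: ltW.
have invN r : N^-1 `^ r = (N `^ r)^-1.
  by rewrite -(powR_inv1 Nge0) -powRrM mulN1r powRN.
have Nn0 : N != 0 by rewrite gt_eqF.
pose u n := `|x n| / N; pose v n := `|w n| / N.
have u0 n : 0 <= u n by rewrite divr_ge0.
have v0 n : 0 <= v n by rewrite divr_ge0.
have uS : series (fun n => u n `^ p) @ \oo --> (1 : R).
  have -> : (fun n => u n `^ p) = (N `^ p)^-1 *: (fun n => `|x n| `^ p : R).
    apply/funext => n; rewrite /u powRM ?normr_ge0 ?invr_ge0//.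
    by rewrite invN mulrC.
  rewrite seriesZ -[X in _ --> X](@mulVf _ (N `^ p)) ?powR_eq0 ?(negbTE Nn0)//.
  by apply: cvgZr; apply/series_cvg_esum => [n|]; rewrite ?powR_ge0 ?lp_norm_sum.
have vS : series (fun n => v n `^ q) @ \oo --> (1 : R).
  have -> : (fun n => v n `^ q) = (N `^ q)^-1 *: (fun n => `|w n| `^ q : R).
    apply/funext => n; rewrite /v powRM ?normr_ge0 ?invr_ge0//.
    by rewrite invN mulrC.
  rewrite seriesZ -[X in _ --> X](@mulVf _ (N `^ q)) ?powR_eq0 ?(negbTE Nn0)//.
  apply: cvgZr; apply/series_cvg_esum => [n|]; first by rewrite powR_ge0.
  by rewrite lp_norm_sum -lp_normE wN.
have wS : series (w \* x) @ \oo --> N ^+ 2 by rewrite -wx; exact: pairing_cvg.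
pose d := (p^-1 *: (fun n => u n `^ p : R)) + (q^-1 *: (fun n => v n `^ q : R))
          - ((N ^+ 2)^-1 *: (w \* x : nat -> R)).
have dE n : d n = (u n `^ p / p + v n `^ q / q - u n * v n)
    + (N ^+ 2)^-1 * (`|w n * x n| - w n * x n).
  rewrite /d /u /v normrM.
  rewrite -[LHS]/(p^-1 * (`|x n| / N) `^ p + q^-1 * (`|w n| / N) `^ q - (N ^+ 2)^-1 * (w n * x n)).
  by field; rewrite Nn0 qn0 pn0.
have y0 n : 0 <= u n `^ p / p + v n `^ q / q - u n * v n.
  by rewrite subr_ge0 conjugate_powR.
have z0 n : 0 <= (N ^+ 2)^-1 * (`|w n * x n| - w n * x n).
  by rewrite mulr_ge0 ?invr_ge0 ?exprn_ge0 ?subr_ge0 ?ler_norm.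
have dS : series d @ \oo --> (0 : R).
  have -> : 0 = p^-1 *: 1 + q^-1 *: 1 - (N ^+ 2)^-1 *: N ^+ 2 :> R.
    rewrite /GRing.scale/= !mulr1 pq mulVf ?subrr// expf_eq0/=; exact: Nn0.
  rewrite /d seriesD seriesD seriesN !seriesZ.
  by apply: cvgB; [apply: cvgD; apply: cvgZr|apply: cvgZr].
have d0 n : 0 <= d n by rewrite dE addr_ge0.
have dn0 n : d n = 0.
  apply/eqP; rewrite eq_le d0 andbT.
  have ser : nondecreasing_seq (series d) by apply: nondecreasing_series.
  have := nondecreasing_cvgn_le ser (cvgP _ dS) n.+1.
  rewrite (cvg_lim _ dS)//; apply: le_trans.
  by rewrite /series/= big_nat_recr//= lerDr sumr_ge0.
have [yE zE] : (forall n, u n * v n = u n `^ p / p + v n `^ q / q) /\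
    (forall n, w n * x n = `|w n * x n|).
  split=> n; have := dn0 n; rewrite dE => /eqP; rewrite paddr_eq0// => /andP[].
    by rewrite subr_eq0 => /eqP.
  by move=> _; rewrite mulf_eq0 invr_eq0 expf_eq0/= (negbTE Nn0)/= subr_eq0
    => /eqP.
apply/lpP => n; rewrite -[RHS]/(J_seq x n) /J_seq -/N.
have uv : v n = u n `^ (p - 1).
  apply: (powR_injective q0); rewrite ?nnegrE ?powR_ge0//.
  by rewrite -powRrM pqE -(young_eq (u0 n) (v0 n) p0 q0 pq (yE n)).
have wn : `|w n| = `|x n| `^ (p - 1) / N `^ (p - 2).
  have -> : `|w n| = v n * N by rewrite /v divfK.
  rewrite uv /u powRM ?normr_ge0 ?invr_ge0// invN.
  rewrite -mulrA; congr (_ * _).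
  rewrite -!powRN -[X in _ * X = _](powRr1 Nge0) -powRD ?Nn0 ?implybT//.
  by congr (_ `^ _); ring.
have [xn|xn] := eqVneq (x n) 0.
  rewrite xn sgr0 mulr0 mul0r; apply/normr0_eq0.
  by rewrite wn xn normr0 powR0 ?mul0r// gt_eqF// subr_gt0.
rewrite mulrAC -wn.
have := zE n; rewrite normrM [`|x n|]normrEsg mulrA => /(mulIf xn).
by [].
Qed.

(* J x is the unique w in l_q such that <w, x> = |x|^2 = |w|^2. *)
Lemma JP (x : lp p1) (w : lp q1) :
  pairing w x = `|x| ^+ 2 /\ `|x| ^+ 2 = `|w| ^+ 2 <-> w = J x.
Proof.
split=> [[wx /eqP]|->]; last by rewrite J_pairing J_norm.
rewrite eqrXn2// => /eqP wN; exact: J_unique.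
Qed.

(* The limit superior is valued in the extended reals and x^' excludes z = x. *)
Definition coderivative_J (x y : lp p1) : set (lp q1) :=
  [set w | (limf_esup (fun z : lp p1 =>
     ((pairing w (z - x) - pairing (J z - J x) y) /
      (`|z - x| + `|J z - J x|))%:E) x^' <= 0)%E].

End duality.
Arguments J_seq {R p p1} x n.
Arguments J {R p q p1} q1 pq x.
Arguments coderivative_J {R p q p1} q1 pq x y.

(* Main.v *)
Require Import Defs.
From mathcomp Require Import all_boot all_order all_algebra.
From mathcomp Require Import all_classical all_reals all_analysis.
From mathcomp Require Import ring lra.
Import Order.TTheory GRing.Theory Num.Theory.
Import numFieldNormedType.Exports.
Local Open Scope classical_set_scope.
Local Open Scope ring_scope.

(** The duality mapping is positively homogeneous, so along the ray through x
    it is linear: for z = (1 + e) * x with |e| < 1, one has z - x = e * x and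
    J z - J x = e * J x.  For w = 0 the quotient defining the coderivative is
    then -e <J x, y> / (|e| (|x| + |J x|)), which depends on e only through its
    sign.  Giving e the sign opposite to that of <J x, y> makes it the positive
    constant |<J x, y>| / (|x| + |J x|), attained at points z <> x arbitrarily
    close to x; hence the limit superior is positive
    ([J_homogeneous], [coderivative_quotient_ray], [limf_esup_ge_frequently]). *)

Lemma limf_esup_ge_frequently (R : realType) (T : choiceType)
    (X : filteredType T) (f : X -> \bar R) (F : set (set X)) (c : \bar R) :
  (forall A, F A -> exists2 z, A z & (c <= f z)%E) -> (c <= limf_esup f F)%E.
Proof.
move=> freq; apply: le_ereal_inf_tmp => _ [A FA <-].
have [z Az cz] := freq _ FA.
by apply: le_trans cz _; apply: ereal_sup_ubound; exists z.
Qed.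

(** A limit superior over x^' only sees points other than x; this makes the
    points of the ray through x usable as witnesses.  The direction s keeps the
    parameter e one-sided, so that the sign of the displacement e * s along x
    is that of s. *)
Lemma near_dnbhs_ray (R : realType) (V : normedModType R) (x : V) (s : R)
    (A : set V) : x != 0 -> s != 0 -> x^' A ->
  \forall e \near 0^'+, A ((1 + e * s) *: x).
Proof.
move=> x0 s0 xA.
have ray : (1 + e * s) *: x @[e --> (0 : R)] --> (1 + 0 * s) *: x.
  apply: cvgZr_tmp; apply: cvgD; first exact: cvg_cst.
  apply: cvgMr_tmp; exact: cvg_id.
rewrite mul0r addr0 scale1r in ray.
have /ray := xA; rewrite /= => rayA.
near=> e.
have e0 : 0 < e by near: e; exact: nbhs_right_gt.
have : (1 + e * s) *: x != x -> A ((1 + e * s) *: x).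
  by near: e; apply: cvg_at_right_filter rayA.
apply; rewrite scalerDl scale1r -subr_eq0 addrAC subrr add0r scaler_eq0.
by rewrite negb_or x0 andbT mulf_neq0.
Unshelve. all: by end_near. Qed.

Section duality_mapping.
Context {R : realType} {p q : R} {p1 : 1 < p} (q1 : 1 < q).
Context (pq : p^-1 + q^-1 = 1).
Implicit Types (x y : lp p1) (w : lp q1).

Lemma pairing0l (x : nat -> R) : pairing (0 : lp q1) x = 0.
Proof.
rewrite /pairing; have -> : series ((0 : lp q1) \* x) = cst 0.
  by apply/funext => n; rewrite /series/= big1// => i _; exact: mul0r.
exact: lim_cst.
Qed.

Lemma pairingZl (a : R) w x : pairing (a *: w) x = a * pairing w x.
Proof.
rewrite /pairing; have -> : series ((a *: w) \* x) = a *: series (w \* x).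
  rewrite -seriesZ; congr series.
  by apply/funext => n; exact/esym/mulrA.
by rewrite limZl_tmp//; exact: pairing_cvg pq _ _.
Qed.

(** The numerator of J has degree p - 1 and its denominator degree p - 2, so
    that a single factor a is left. *)
Lemma J_homogeneous (a : R) x : 0 < a -> J q1 pq (a *: x) = a *: J q1 pq x.
Proof.
move=> a0; apply/lpP => n.
have axn : lp_seq (a *: x) n = a * x n by [].
rewrite -[LHS]/(J_seq (a *: x) n) -[RHS]/(a * J_seq x n) /J_seq axn.
rewrite [`|a *: x|]normrZ normrM sgrM (gtr0_norm a0) (gtr0_sg a0) mul1r.
rewrite !powRM ?normr_ge0 ?(ltW a0)//.
have -> : a `^ (p - 1) = a * a `^ (p - 2).
  rewrite -[X in X * _](powRr1 (ltW a0)) -powRD ?(gt_eqF a0) ?implybT//.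
  by congr (_ `^ _); ring.
rewrite invfM -[RHS]mul1r -[X in _ = X * _](@mulfV _ (a `^ (p - 2))).
  by ring.
by rewrite gt_eqF ?powR_gt0.
Qed.

(** The factor |e| cancels because J moves along the ray by e * J x.  With the
    conventions on division and on the sign of 0, the degenerate cases e = 0 and
    x = 0 make both sides vanish. *)
Lemma coderivative_quotient_ray x y (e : R) (z := (1 + e) *: x) : `|e| < 1 ->
  (pairing (0 : lp q1) (z - x) - pairing (J q1 pq z - J q1 pq x) y) /
    (`|z - x| + `|J q1 pq z - J q1 pq x|) =
  - Num.sg e * (pairing (J q1 pq x) y / (`|x| + `|J q1 pq x|)).
Proof.
move=> e1; have e10 : 0 < 1 + e by move: e1; rewrite ltr_norml; lra.
have ray (V : lmodType R) (v : V) : (1 + e) *: v - v = e *: v.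
  by rewrite scalerDl scale1r addrAC subrr add0r.
rewrite /z J_homogeneous// !ray pairing0l sub0r pairingZl !normrZ -mulrDr.
have [->|e0] := eqVneq e 0; first by rewrite sgr0 !mul0r oppr0 !mul0r.
rewrite {1}[e]numEsg invfM.
rewrite -[RHS]mul1r -[X in _ = X * _](@mulfV _ `|e|) ?normr_eq0//.
by ring.
Qed.

End duality_mapping.

Theorem theorem3p2 (R : realType) (p q : R) (p1 : 1 < p) (q1 : 1 < q)
    (pq : p^-1 + q^-1 = 1) (x y : lp p1) :
  pairing (J q1 pq x) y <> 0 -> ~ coderivative_J q1 pq x y 0.
Proof.
set a := pairing _ _ => /eqP a0.
have x0 : x != 0.
  apply: contraNneq a0 => x0; rewrite /a (_ : J q1 pq x = 0) ?pairing0l//.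
  by apply/normr0_eq0; rewrite J_norm x0 normr0.
have s0 : - Num.sg a != 0 by rewrite oppr_eq0 sgr_eq0.
pose c := `|a| / (`|x| + `|J q1 pq x|).
have c0 : 0 < c by rewrite divr_gt0 ?normr_gt0// ltr_wpDr ?normr_gt0.
apply/negP; rewrite -ltNge; apply: (@lt_le_trans _ _ c%:E); first by rewrite lte_fin.
apply: limf_esup_ge_frequently => A xA.
have [e [e0 e1 Ae]] : exists e, [/\ 0 < e, e < 1 & A ((1 + e * - Num.sg a) *: x)].
  near (0 : R)^'+ => e; exists e; split.
  - by near: e; exact: nbhs_right_gt.
  - by near: e; exact: nbhs_right_lt.
  - by near: e; exact: near_dnbhs_ray.
(* The displacement is opposite in sign to a, so the quotient equals c. *)
exists ((1 + e * - Num.sg a) *: x) => //.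
rewrite lee_fin coderivative_quotient_ray.
  rewrite sgrM (gtr0_sg e0) mul1r sgrN sgr_id opprK mulrA.
  by rewrite -normrEsg.
by rewrite normrM normrN normr_sg a0 mulr1 gtr0_norm.
Unshelve. all: by end_near. Qed.
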